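(* Let $\mathfrak t$ be a semibounded sesquilinear form in a complex Hilbert space $\mathfrak H$. If $\mathfrak t$ is closable, then $\mathfrak t$ has a closure $\bar{\mathfrak t}$ (the smallest closed form extension of $\mathfrak t$), defined as follows: $\operatorname{dom}\bar{\mathfrak t}$ consists of all $\varphi\in\mathfrak H$ for which there exists a sequence $\varphi_n\in\operatorname{dom}\mathfrak t$ with $\varphi_n\to_{\mathfrak t}\varphi$, and in this case $$\bar{\mathfrak t}[\varphi,\psi]=\lim_{n\to\infty}\mathfrak t[\varphi_n,\psi_n]\quad\text{for any}\quad \varphi_n\to_{\mathfrak t}\varphi,\ \psi_n\to_{\mathfrak t}\psi .$$ The forms $\mathfrak t$ and $\bar{\mathfrak t}$ have the same lower bound. In fact, if $c\le m(\mathfrak t)$ and $Q_c$ is a closable representing map for $\mathfrak t-c$, i.e. a closable linear operator from $\mathfrak H$ to a Hilbert space $\mathfrak K$ with $\operatorname{dom}Q_c=\operatorname{dom}\mathfrak t$ and $\mathfrak t[\varphi,\psi]-c(\varphi,\psi)=(Q_c\varphi,Q_c\psi)_{\mathfrak K}$ for all $\varphi,\psi\in\operatorname{dom}\mathfrak t$, then $\bar{\mathfrak t}$ is given by $$\bar{\mathfrak t}[\varphi,\psi]-c(\varphi,\psi)=(Q_c^{**}\varphi,Q_c^{**}\psi)_{\mathfrak K},\qquad \varphi,\psi\in\operatorname{dom}\bar{\mathfrak t}=\operatorname{dom}Q_c^{**},$$ where $Q_c^{**}$ denotes the closure of $Q_c$.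
   Context: A (sesquilinear) form $\mathfrak t$ in $\mathfrak H$ is a map $\operatorname{dom}\mathfrak t\times\operatorname{dom}\mathfrak t\to\mathbb C$, linear in the first and antilinear in the second entry, where $\operatorname{dom}\mathfrak t$ is a (not necessarily dense) linear subspace of $\mathfrak H$; $\mathfrak t[\varphi]=\mathfrak t[\varphi,\varphi]$. It is semibounded if there is $c\in\mathbb R$ with $\mathfrak t[\varphi]\ge c\|\varphi\|^2$ for all $\varphi\in\operatorname{dom}\mathfrak t$; the greatest such $c$ is the lower bound $m(\mathfrak t)\in\mathbb R$ (so $\operatorname{dom}\mathfrak t\neq\{0\}$ is understood). For $\varphi_n\in\operatorname{dom}\mathfrak t$ and $\varphi\in\mathfrak H$, $\varphi_n\to_{\mathfrak t}\varphi$ means $\varphi_n\to\varphi$ in $\mathfrak H$ and $\mathfrak t[\varphi_n-\varphi_m]\to0$. The form $\mathfrak t$ is closable if $\varphi_n\to_{\mathfrak t}0$ (with $\varphi_n\in\operatorname{dom}\mathfrak t$) implies $\mathfrak t[\varphi_n]\to0$; it is closed if $\varphi_n\to_{\mathfrak t}\varphi$ implies $\varphi\in\operatorname{dom}\mathfrak t$ and $\mathfrak t[\varphi_n-\varphi]\to0$. A form $\mathfrak t'$ is an extension of $\mathfrak t$ if $\operatorname{dom}\mathfrak t\subset\operatorname{dom}\mathfrak t'$ and $\mathfrak t'$ agrees with $\mathfrak t$ on $\operatorname{dom}\mathfrak t$; ''smallest'' refers to this inclusion of (semibounded) forms. The operator $Q_c$ need not be densely defined; $Q_c^{**}$ is the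 operator whose graph is the closure of the graph of $Q_c$. *)

(* Defs.v *)
From HB Require Import structures.
From mathcomp Require Import all_boot all_order all_algebra.
From mathcomp Require Import complex.
From mathcomp Require Import all_classical all_reals all_analysis.

Set Implicit Arguments.
Unset Strict Implicit.
Unset Printing Implicit Defensive.

Import Order.TTheory GRing.Theory Num.Theory.
Import numFieldNormedType.Exports.

Local Open Scope classical_set_scope.
Local Open Scope ring_scope.

(* The inner product is linear in the first and antilinear in the second
   argument. *)
HB.mixin Record NormedModule_isHilbert (R : realType) (H : Type)
    & CompleteNormedModule R[i] H := {
  inner : {dot H for Num.conj} ;
  sqr_normE : forall x : H, `|x| ^+ 2 = inner x x
}.

#[short(type="hilbertType")]
HB.structure Definition Hilbert (R : realType) :=
  { H of CompleteNormedModule R[i] H & NormedModule_isHilbert R H }.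

Definition linear_subspace (R : realType) (V : lmodType R[i]) (D : set V) :=
  D 0 /\ forall (a : R[i]) x y, D x -> D y -> D (a *: x + y).

(* The values of form_val outside form_dom are irrelevant: no notion below
   depends on them. *)
Record sesqform (R : realType) (H : hilbertType R) := Form {
  form_dom : set H ;
  form_val :> H -> H -> R[i] ;
  form_domP : linear_subspace form_dom ;
  form_linear : forall a x y z, form_dom x -> form_dom y -> form_dom z ->
    form_val (a *: x + y) z = a * form_val x z + form_val y z ;
  form_antilinear : forall a x y z, form_dom x -> form_dom y -> form_dom z ->
    form_val z (a *: x + y) = a^* * form_val z x + form_val z y
}.

Section Forms.
Variables (R : realType) (H : hilbertType R).
Implicit Types (t s : sesqform H) (u : nat -> H) (x y : H) (c : R).

(* The order of R[i] compares only numbers with the same imaginary part, so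
   this includes that t x x is real. *)
Definition form_ge t c :=
  forall x, form_dom t x -> c%:C%C * `|x| ^+ 2 <= t x x.

Definition semibounded t := exists c, form_ge t c.

Definition lower_bound t : R := sup [set c | form_ge t c].

(* Under the standing assumptions the supremum is the greatest element. *)
Lemma lower_boundP t : (exists2 x, form_dom t x & x != 0) -> semibounded t ->
  form_ge t (lower_bound t) /\ forall c, form_ge t c -> c <= lower_bound t.
Proof.
have normE x : `|x| ^+ 2 = (complex.Re (`|x| ^+ 2))%:C%C.
  by have := exprn_ge0 2 (normr_ge0 x); case: (`|x| ^+ 2) => a b;
     rewrite lecE /= => /andP[/eqP -> _].
have geE c x : (c%:C%C * `|x| ^+ 2 <= t x x) =
    (complex.Im (t x x) == 0) && (c * complex.Re (`|x| ^+ 2) <= complex.Re (t x x)).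
  by rewrite [in LHS]normE -rmorphM lecE.
have Re_gt0 x : x != 0 -> 0 < complex.Re (`|x| ^+ 2).
  move=> x0; have : 0 < `|x| ^+ 2 by rewrite exprn_gt0 // normr_gt0.
  by rewrite [in X in X -> _]normE ltcR.
move=> [x tx x0] [c0 tc0].
have ub y c : form_dom t y -> y != 0 -> form_ge t c ->
    c <= complex.Re (t y y) / complex.Re (`|y| ^+ 2).
  move=> ty y0 /(_ y ty); rewrite geE => /andP[_].
  by rewrite ler_pdivlMr ?Re_gt0.
split=> [y ty|c tc]; last first.
  apply: ub_le_sup => //; exists (complex.Re (t x x) / complex.Re (`|x| ^+ 2)).
  by move=> d /= td; exact: ub.
have := tc0 y ty; rewrite !geE => /andP[-> /=].
have [->|y0] := eqVneq y 0; first by rewrite normr0 expr0n /= !mulr0.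
move=> _; rewrite -ler_pdivlMr ?Re_gt0 //; apply: ge_sup; first by exists c0.
by move=> d /= td; exact: ub.
Qed.

Definition form_cvg t u x :=
  [/\ forall n, form_dom t (u n), u n @[n --> \oo] --> x &
      t (u nm.1 - u nm.2) (u nm.1 - u nm.2) @[nm --> (\oo, \oo)] --> (0 : R[i]^o)].

Definition form_closable t :=
  forall u, form_cvg t u 0 -> t (u n) (u n) @[n --> \oo] --> (0 : R[i]^o).

Definition form_closed t :=
  forall u x, form_cvg t u x ->
    form_dom t x /\ t (u n - x) (u n - x) @[n --> \oo] --> (0 : R[i]^o).

Definition form_extension t s :=
  form_dom t `<=` form_dom s /\
  forall x y, form_dom t x -> form_dom t y -> s x y = t x y.

Definition form_closure t tb :=
  [/\ semibounded tb, form_closed tb, form_extension t tb &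
      forall s, semibounded s -> form_closed s -> form_extension t s ->
        form_extension tb s].

End Forms.

Record operator (R : realType) (H K : hilbertType R) := Operator {
  op_dom : set H ;
  op_val :> H -> K ;
  op_domP : linear_subspace op_dom ;
  op_linear : forall a x y, op_dom x -> op_dom y ->
    op_val (a *: x + y) = a *: op_val x + op_val y
}.

Section Operators.
Variables (R : realType) (H K : hilbertType R).
Implicit Types (Q : operator H K) (t : sesqform H).

Definition op_graph Q : set (H * K) :=
  [set p | op_dom Q p.1 /\ p.2 = Q p.1].

Definition op_closable Q :=
  forall x y z, closure (op_graph Q) (x, y) -> closure (op_graph Q) (x, z) ->
    y = z.

Definition op_closure Q Qb := op_graph Qb = closure (op_graph Q).

(* Q is a representing map for the form t - c. *)
Definition representing_map t (c : R) Q :=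
  op_dom Q = form_dom t /\
  forall x y, form_dom t x -> form_dom t y ->
    t x y - c%:C%C * inner x y = inner (Q x) (Q y).

End Operators.

(* Main.v *)
(* Subtracting a lower bound reduces everything to forms q >= 0.  For such forms
   polarization gives |q(x,y)| <= s q(x) + q(y)/s for every s > 0, so that
   q(f,g) - q(f',g') -> 0 as soon as q(f-f') -> 0, q(g-g') -> 0 and q(g), q(f')
   stay bounded.  Along pairs of indices this makes t[u_n,v_n] Cauchy;
   closability makes its limit independent of the chosen sequences, and the
   limit defines the closure.  Closedness is a diagonal argument, and a closed
   semibounded extension is itself closable, so its values are the same
   limits.  For a representing map Q of t - c one has
   |Q x - Q y|^2 = (t - c)[x - y], so u_n ->_t x iff u_n -> x and Q u_n
   converges, i.e. the closure of t lives on the closure of the graph of Q. *)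

Require Import Defs.
From HB Require Import structures.
From mathcomp Require Import all_boot all_order all_algebra.
From mathcomp Require Import complex.
From mathcomp Require Import all_classical all_reals all_analysis.
From mathcomp Require Import ring.

Set Implicit Arguments.
Unset Strict Implicit.
Unset Printing Implicit Defensive.

Import Order.TTheory GRing.Theory Num.Theory.
Import numFieldNormedType.Exports.

Local Open Scope classical_set_scope.
Local Open Scope ring_scope.

(** * Limits along pairs of indices *)

Lemma near_pairP (P : nat * nat -> Prop) :
  (\forall nm \near (\oo, \oo), P nm) <->
  exists N, forall n m, (N <= n)%N -> (N <= m)%N -> P (n, m).
Proof.
split=> [[[A B] /= [[N1 _ A1] [N2 _ B1]] AB]|[N NP]].
  exists (maxn N1 N2) => n m; rewrite !geq_max => /andP[n1 _] /andP[_ m2].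
  by apply: (AB (n, m)); split; [exact: A1|exact: B1].
exists ([set n | (N <= n)%N], [set n | (N <= n)%N]) => /=.
  by split; exists N.
by case=> n m [/=]; exact: NP.
Qed.

(** * Limits of complex numbers *)

Section ComplexLimits.
Variable R : realType.
Local Notation C := R[i].

(* R[i] carries no canonical topology, only its copy R[i]^o does; these restate
   the limit laws for functions with values in R[i]. *)
Section Algebra.
Variables (T : Type) (F : set_system T).
Implicit Types (f g : T -> C) (a b : C).

Lemma eq_ccvg f g a b : f x @[x --> F] --> (a : C^o) ->
  f =1 g -> a = b -> g x @[x --> F] --> (b : C^o).
Proof. by move=> fa /funext <- <-. Qed.

Lemma ccvgD {FF : Filter F} f g a b :
  f x @[x --> F] --> (a : C^o) -> g x @[x --> F] --> (b : C^o) ->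
  f x + g x @[x --> F] --> (a + b : C^o).
Proof. exact: (@cvgD _ C^o _ _ _ (f : T -> C^o)). Qed.

Lemma ccvgMl {FF : Filter F} c f a :
  f x @[x --> F] --> (a : C^o) -> c * f x @[x --> F] --> (c * a : C^o).
Proof. exact: (@cvgMl_tmp C _ _ _ f). Qed.

Lemma ccvgB {FF : Filter F} f g a b :
  f x @[x --> F] --> (a : C^o) -> g x @[x --> F] --> (b : C^o) ->
  f x - g x @[x --> F] --> (a - b : C^o).
Proof. exact: (@cvgB _ C^o _ _ _ (f : T -> C^o)). Qed.

Lemma ccvg_unique {FF : ProperFilter F} f a b :
  f x @[x --> F] --> (a : C^o) -> f x @[x --> F] --> (b : C^o) -> a = b.
Proof. by move=> fa fb; exact: (cvg_unique (@norm_hausdorff _ C^o) fa fb). Qed.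

Lemma ccvg_sub0 {FF : Filter F} f a :
  f x - a @[x --> F] --> (0 : C^o) -> f x @[x --> F] --> (a : C^o).
Proof. exact: (@subr_cvg0 _ C^o _ _ _ f a).1. Qed.

End Algebra.

(** Where [f] is nonnegative it coincides with its modulus, so [f] also tends to [|l|]; uniqueness
    of limits gives [l = |l|]. *)
Lemma cvg_ge0 (T : Type) (F : set_system T) {FF : ProperFilter F}
    (f : T -> C^o) (l : C^o) :
  (\forall x \near F, 0 <= f x) -> f x @[x --> F] --> l -> 0 <= l.
Proof.
move=> f0 fl.
suff fln : f x @[x --> F] --> (`|l| : C^o).
  by rewrite (cvg_unique (@norm_hausdorff _ C^o) fl fln).
apply: (cvg_trans _ (cvg_norm fl)); apply: near_eq_cvg.
by apply: filterS f0 => x /normr_idP.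
Qed.

Lemma cvg_dominated0 (T : Type) (F : set_system T) {FF : Filter F}
    (V : normedModType C) (f : T -> V) (g : T -> C^o) :
  (\forall x \near F, `|f x| <= g x) -> g x @[x --> F] --> (0 : C^o) ->
  f x @[x --> F] --> (0 : V).
Proof.
move=> fg /cvgr0Pnorm_le g0; apply/cvgr0Pnorm_le => e e0.
have := g0 e e0; apply: filterS2 fg => x fx ge.
(* The order on [R[i]] is partial: [g x] is comparable with its modulus because it lies above
   [|f x|] and is therefore real. *)
rewrite (le_trans fx) // (le_trans _ ge) // real_ler_norm //.
by rewrite ger0_real // (le_trans _ fx).
Qed.

Lemma pair_cvg0P (V : normedModType C) (f : nat * nat -> V) :
  f nm @[nm --> (\oo, \oo)] --> (0 : V) <->
  forall e : C, 0 < e ->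
    exists N, forall n m, (N <= n)%N -> (N <= m)%N -> `|f (n, m)| < e.
Proof.
have P e : (\forall nm \near (\oo, \oo), `|f nm| < e) <-> _ := near_pairP _.
split=> [f0 e e0|f0].
  by apply/P; exact: (@cvgr0_norm_lt _ _ _ _ _ f f0).
by apply: (@cvgr0Pnorm_lt _ _ _ _ _ f).2 => e /f0/P.
Qed.

(** A positive element of [R[i]] is real, so each tolerance [e] comes from its real part, and the
    embedding of [R] preserves moduli. *)
Lemma ccvg_real (T : Type) (F : set_system T) {FF : Filter F} (f : T -> R)
    (a : R) :
  f x @[x --> F] --> a -> (f x)%:C%C @[x --> F] --> (a%:C%C : C^o).
Proof.
move=> /cvgrPdist_lt fa; apply/(@cvgrPdist_lt _ C^o) => e e0.
have eE : e = (complex.Re e)%:C%C.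
  by have := gtr0_norm e0; rewrite normc_def => <-.
have {}/fa : 0 < complex.Re e by rewrite -ltcR -eE.
apply: filterS => x h.
by rewrite eE -rmorphB normc_def /= expr0n addr0 sqrtr_sqr ltcR.
Qed.

(** Completeness is inherited from [R]: real and imaginary parts are additive and do not increase
    the modulus, so both are Cauchy, and their limits are recombined. *)
Lemma complex_cauchy_cvg (f : nat -> C) :
  f nm.1 - f nm.2 @[nm --> (\oo, \oo)] --> (0 : C^o) ->
  exists l : C^o, f n @[n --> \oo] --> l.
Proof.
move=> /(pair_cvg0P (V := C^o)) f0.
have cv (p : C -> R) : {morph p : x y / x - y} ->
    (forall z, `|p z|%:C%C <= `|z|) ->
    exists a, (p (f n))%:C%C @[n --> \oo] --> (a : C^o).
  move=> pB ple.
  have : cvg (p (f n) @[n --> \oo]).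
    apply/cauchy_cvgP; apply: cauchy_exP => e e0.
    have e0C : 0 < e%:C%C :> C by rewrite ltcR.
    have [N NP] := f0 _ e0C; exists (p (f N)); exists N => // n /= nN.
    have /= := NP N n (leqnn N) nN.
    by rewrite /ball /= -pB => /(le_lt_trans (ple _)); rewrite ltcR.
  by move=> /cvg_ex[a pa]; exists a%:C%C; exact: ccvg_real pa.
have ReP (z : C) : `|complex.Re z|%:C%C <= `|z| by exact: normc_ge_Re.
have ImP (z : C) : `|complex.Im z|%:C%C <= `|z|.
  rewrite normc_def lecR -sqrtr_sqr ler_sqrt ?addr_ge0 ?sqr_ge0 //.
  by rewrite lerDr sqr_ge0.
have ReB : {morph (@complex.Re R) : x y / x - y} by case=> ? ? [].
have ImB : {morph (@complex.Im R) : x y / x - y} by case=> ? ? [].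
have [[a fa] [b fb]] := (cv _ ReB ReP, cv _ ImB ImP).
exists (a + 'i%C * b).
apply: (eq_ccvg (ccvgD fa (ccvgMl (c := 'i%C) fb))) => [n|//].
by rewrite [in RHS](complexE (f n)).
Qed.

Lemma ccvg_harmonic : (n.+1%:R^-1)%:C%C @[n --> \oo] --> (0 : C^o).
Proof. exact: ccvg_real (@cvg_harmonic R). Qed.

Lemma ccvg_norm_le (T : Type) (F : set_system T) {FF : ProperFilter F}
    (f : T -> C) (l e : C) :
  (\forall x \near F, `|f x| <= e) -> f x @[x --> F] --> (l : C^o) ->
  `|l| <= e.
Proof.
move=> fe fl; rewrite -subr_ge0.
apply: (@cvg_ge0 _ F _ (fun x => e - `|f x|)).
  by apply: filterS fe => x; rewrite subr_ge0.
have fn : `|f x| @[x --> F] --> (`|l| : C^o).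
  exact: (@cvg_norm _ C^o _ _ _ _ _ fl).
have fe' : (fun=> e) @ F --> (e : C^o) by exact: (@cvg_cst C^o).
exact: ccvgB fe' fn.
Qed.

Lemma ccvg_sqr_norm0 (T : Type) (F : set_system T) {FF : Filter F}
    (V : normedModType C) (f : T -> V) :
  `|f x| ^+ 2 @[x --> F] --> (0 : C^o) <-> f x @[x --> F] --> (0 : V).
Proof.
split=> [|f0].
  move=> /(@cvgr0Pnorm_lt _ C^o) f0; apply/cvgr0Pnorm_lt => e e0.
  have {f0} := f0 _ (exprn_gt0 2 e0); apply: filterS => x.
  by rewrite normrX normr_id ltr_pXn2r ?nnegrE ?normr_ge0 ?(ltW e0).
have nf : `|f x| @[x --> F] --> (0 : C^o).
  by rewrite -(normr0 V); exact: cvg_norm f0.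
rewrite -(mulr0 (0 : C)).
exact: (@cvgM C _ _ _ (fun x => `|f x|) (fun x => `|f x|)).
Qed.

End ComplexLimits.

(** * Nonnegative forms *)

Section FormAlgebra.
Variables (R : realType) (H : hilbertType R) (t : sesqform H).
Local Notation C := R[i].
Local Notation D := (form_dom t).
Implicit Types (a : C) (x y z : H).

Lemma form_dom0 : D 0. Proof. by case: (form_domP t). Qed.

Lemma form_dom_lin a x y : D x -> D y -> D (a *: x + y).
Proof. by case: (form_domP t) => _; apply. Qed.

Lemma form_domZ a x : D x -> D (a *: x).
Proof. by move=> /(form_dom_lin a)/(_ form_dom0); rewrite addr0. Qed.

Lemma form_domD x y : D x -> D y -> D (x + y).
Proof. by rewrite -[x in D (x + _)]scale1r; exact: form_dom_lin. Qed.

Lemma form_domB x y : D x -> D y -> D (x - y).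
Proof. by move=> Dx Dy; rewrite addrC -scaleN1r; exact: form_dom_lin. Qed.

Lemma form0l z : D z -> t 0 z = 0.
Proof.
move=> Dz; have := form_linear 1 form_dom0 form_dom0 Dz.
by rewrite scaler0 addr0 mul1r -[LHS]addr0 => /addrI.
Qed.

Lemma form0r z : D z -> t z 0 = 0.
Proof.
move=> Dz; have := form_antilinear 1 form_dom0 form_dom0 Dz.
by rewrite scaler0 addr0 conjC1 mul1r -[LHS]addr0 => /addrI.
Qed.

Lemma formDl x y z : D x -> D y -> D z -> t (x + y) z = t x z + t y z.
Proof.
by move=> Dx Dy Dz; rewrite -[x in LHS]scale1r form_linear // mul1r.
Qed.

Lemma formDr x y z : D x -> D y -> D z -> t z (x + y) = t z x + t z y.
Proof.
by move=> Dx Dy Dz; rewrite -[x in LHS]scale1r form_antilinear // conjC1 mul1r.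
Qed.

Lemma formZl a x z : D x -> D z -> t (a *: x) z = a * t x z.
Proof.
move=> Dx Dz; rewrite -[X in t X z]addr0 form_linear ?form0l ?addr0 //.
exact: form_dom0.
Qed.

Lemma formZr a x z : D x -> D z -> t z (a *: x) = a^* * t z x.
Proof.
move=> Dx Dz; rewrite -[X in t z X]addr0 form_antilinear ?form0r ?addr0 //.
exact: form_dom0.
Qed.

Lemma formBl x y z : D x -> D y -> D z -> t (x - y) z = t x z - t y z.
Proof.
by move=> Dx Dy Dz; rewrite addrC -scaleN1r form_linear // mulN1r addrC.
Qed.

Lemma formBr x y z : D x -> D y -> D z -> t z (x - y) = t z x - t z y.
Proof.
move=> Dx Dy Dz; rewrite addrC -scaleN1r form_antilinear //.
by rewrite rmorphN1 mulN1r addrC.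
Qed.

Lemma form_parallelogram x y : D x -> D y ->
  t (x + y) (x + y) + t (x - y) (x - y) = 2 * (t x x + t y y).
Proof.
move=> Dx Dy; have Dp := form_domD Dx Dy; have Dm := form_domB Dx Dy.
by rewrite formBl // !formBr // formDl // !formDr //; ring.
Qed.

(** In the expansion the terms [t y x] cancel, because conjugation turns ['i] into [- 'i] in the
    second argument. *)
Lemma form_polarization x y : D x -> D y ->
  4 * t x y = t (x + y) (x + y) - t (x - y) (x - y)
    + 'i * (t (x + 'i *: y) (x + 'i *: y) - t (x - 'i *: y) (x - 'i *: y)).
Proof.
move=> Dx Dy; have Diy := form_domZ 'i Dy.
have [Dp Dm] := (form_domD Dx Dy, form_domB Dx Dy).
have [Dip Dim] := (form_domD Dx Diy, form_domB Dx Diy).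
rewrite !formBl // !formBr // !formDl // !formDr // !formZl // !formZr //.
rewrite conjCi.
have i2 := @sqrCi C; ring: i2.
Qed.

Hypothesis t_ge0 : form_ge t 0.

Lemma form_ge0 x : D x -> 0 <= t x x.
Proof. by move=> /t_ge0; rewrite mul0r. Qed.

Lemma form_sum_le x y : D x -> D y ->
  t (x + y) (x + y) <= 2 * (t x x + t y y).
Proof.
move=> Dx Dy; rewrite -form_parallelogram // lerDl form_ge0 //.
exact: form_domB.
Qed.

Lemma form_sub_le x y : D x -> D y ->
  t (x - y) (x - y) <= 2 * (t x x + t y y).
Proof.
move=> Dx Dy; rewrite -form_parallelogram // lerDr form_ge0 //.
exact: form_domD.
Qed.

(** Polarization bounds [4 |t x y|] by four nonnegative diagonal values, and the parallelogram
    identity evaluates their sum. *)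
Lemma form_norm_le x y : D x -> D y -> `|t x y| <= t x x + t y y.
Proof.
move=> Dx Dy; have Diy := form_domZ 'i Dy.
have n4 : `|4 : C| = 4 by rewrite normr_nat.
rewrite -(@ler_pM2l _ 4) // -{1}n4 -normrM form_polarization //.
(* Since [t ('i *: y) ('i *: y) = t y y], the right side splits into two parallelogram sums, one for
   [y] and one for ['i *: y]. *)
have -> : 4 * (t x x + t y y) = 2 * (t x x + t y y)
    + 2 * (t x x + t ('i *: y) ('i *: y)).
  rewrite formZl ?formZr // conjCi mulrA mulrN -expr2 sqrCi opprK mul1r.
  by ring.
rewrite -!form_parallelogram //.
have := (form_ge0 (form_domD Dx Dy), form_ge0 (form_domB Dx Dy)).
have := (form_ge0 (form_domD Dx Diy), form_ge0 (form_domB Dx Diy)).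
move=> [/ger0_norm p1 /ger0_norm p2] [/ger0_norm p3 /ger0_norm p4].
rewrite (le_trans (ler_normD _ _)) // lerD //.
  by rewrite (le_trans (ler_normB _ _)) // p3 p4.
by rewrite normrM normCi mul1r (le_trans (ler_normB _ _)) // p1 p2.
Qed.

(* A substitute for the Cauchy-Schwarz inequality that needs neither the
   hermitian symmetry of [t] nor square roots. *)
Lemma form_norm_le_scale (s : C) x y : 0 < s -> D x -> D y ->
  `|t x y| <= s * t x x + s^-1 * t y y.
Proof.
move=> s0 Dx Dy; have Dsx := form_domZ s Dx.
rewrite -(ler_pM2l s0) -{1}(gtr0_norm s0) -normrM -(formZl s Dx Dy).
apply: le_trans (form_norm_le Dsx Dy) _.
rewrite formZl ?formZr // (CrealP (gtr0_real s0)) mulrDr.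
by rewrite (mulrA s s^-1) divff ?gt_eqF // mul1r.
Qed.

End FormAlgebra.

(** * Convergence for nonnegative forms *)

Section NonnegativeForms.
Variables (R : realType) (H : hilbertType R) (t : sesqform H).
Hypothesis t_ge0 : form_ge t 0.
Local Notation C := R[i].
Local Notation D := (form_dom t).

Section AlongFilter.
Variables (T : Type) (F : set_system T) (FF : Filter F).
Implicit Types f g : T -> H.

(** The weighted bound makes the small diagonal of [f] beat the bounded one of [g]. Both orders of
    the arguments are recorded, since hermitian symmetry is not derived here. *)
Lemma form_cross_cvg0 f g (B : C) : 0 < B ->
  (forall x, D (f x)) -> (forall x, D (g x)) ->
  t (f x) (f x) @[x --> F] --> (0 : C^o) ->
  (\forall x \near F, t (g x) (g x) <= B) ->
  t (f x) (g x) @[x --> F] --> (0 : C^o) /\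
  t (g x) (f x) @[x --> F] --> (0 : C^o).
Proof.
move=> B0 Df Dg f0 gB.
have small (e : C) : 0 < e ->
    \forall x \near F, `|t (f x) (g x)| <= e /\ `|t (g x) (f x)| <= e.
  (* The weight is chosen so that [B / s = e / 2]; the other summand is at most [e / 2] once
     [t (f x) (f x) <= e / 2 / s]. *)
  move=> e0; pose s : C := 2 * B / e.
  have s0 : 0 < s by rewrite divr_gt0 ?mulr_gt0.
  have es0 : 0 < e / 2 / s by rewrite divr_gt0 // divr_gt0.
  have fe : \forall x \near F, `|t (f x) (f x)| <= e / 2 / s.
    exact: (@cvgr0_norm_le _ C^o _ _ _ _ f0 _ es0).
  apply: filterS2 gB fe => x gB fe.
  have le_e : s * t (f x) (f x) + s^-1 * t (g x) (g x) <= e.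
    rewrite [e in _ <= e]splitr lerD //.
      rewrite mulrC -ler_pdivlMr // (le_trans _ fe) // ger0_norm //.
      exact: form_ge0.
    rewrite mulrC ler_pdivrMr //.
    have -> // : e / 2 * s = B by rewrite /s; field; rewrite gt_eqF.
  split; apply: le_trans le_e; first exact: form_norm_le_scale.
  (* With [g x] in the first argument the same sum is the weighted bound for [s^-1]. *)
  rewrite addrC -{2}[s]invrK; apply: form_norm_le_scale => //.
  by rewrite invr_gt0.
by split; apply/(@cvgr0Pnorm_le _ C^o) => e /small; apply: filterS => x [].
Qed.

(** The difference equals [t (f - f') g + t f' (g - g')], and each summand pairs a null family with
    a bounded one. *)
Lemma form_diff_cvg0 f g f' g' (B : C) : 0 < B ->
  (forall x, D (f x)) -> (forall x, D (g x)) ->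
  (forall x, D (f' x)) -> (forall x, D (g' x)) ->
  t (f x - f' x) (f x - f' x) @[x --> F] --> (0 : C^o) ->
  t (g x - g' x) (g x - g' x) @[x --> F] --> (0 : C^o) ->
  (\forall x \near F, t (g x) (g x) <= B) ->
  (\forall x \near F, t (f' x) (f' x) <= B) ->
  t (f x) (g x) - t (f' x) (g' x) @[x --> F] --> (0 : C^o).
Proof.
move=> B0 Df Dg Df' Dg' ff gg gB f'B.
have Dff x : D (f x - f' x) by exact: form_domB.
have Dgg x : D (g x - g' x) by exact: form_domB.
have [h1 _] := form_cross_cvg0 B0 Dff Dg ff gB.
have [_ h2] := form_cross_cvg0 B0 Dgg Df' gg f'B.
apply: (eq_ccvg (ccvgD h1 h2)) => [x|]; last by rewrite addr0.
by rewrite formBl // formBr // addrA subrK.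
Qed.

End AlongFilter.

(** Beyond some [N] one has [t[u_n - u_N] < 1], and [u_n] is the sum of [u_n - u_N] and the fixed
    vector [u_N]. *)
Lemma form_cvg_bounded u x : form_cvg t u x ->
  exists B : C, 0 < B /\ \forall n \near \oo, t (u n) (u n) <= B.
Proof.
move=> [Du _ /(pair_cvg0P (V := C^o)) u0].
have [N NP] := u0 1 ltr01.
have p := form_ge0 t_ge0 (Du N).
exists (2 * (1 + t (u N) (u N))); split.
  by rewrite mulr_gt0 // ltr_pwDl.
exists N => // n /= nN; rewrite -{1 2}[u n](subrK (u N)).
apply: le_trans (form_sum_le t_ge0 _ _) _ => //; first exact: form_domB.
rewrite ler_pM2l // lerD2r; have /= := ltW (NP n N nN (leqnn N)).
by rewrite ger0_norm //; apply: form_ge0 => //; exact: form_domB.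
Qed.

(** Over pairs [(n, m)], the terms of index [n] are compared with those of index [m]; the values
    [t (u n) (v n)] are then Cauchy. *)
Lemma form_cvg_cauchy u v x y : form_cvg t u x -> form_cvg t v y ->
  exists l : C^o, t (u n) (v n) @[n --> \oo] --> l.
Proof.
move=> ux vy; have [[Bu [Bu0 uB]] [Bv [Bv0 vB]]] :=
  (form_cvg_bounded ux, form_cvg_bounded vy).
case: ux vy => [Du _ u0] [Dv _ v0]; apply: complex_cauchy_cvg.
apply: (@form_diff_cvg0 _ _ _ (u \o fst) (v \o fst) (u \o snd) (v \o snd)
  (Bu + Bv)) => //=; first by rewrite addr_gt0.
- case: vB => N _ NP; apply/near_pairP; exists N => n m nN _ /=.
  by apply: le_trans (NP n nN) _; rewrite lerDr ltW.
- case: uB => N _ NP; apply/near_pairP; exists N => n m _ mN /=.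
  by apply: le_trans (NP m mN) _; rewrite lerDl ltW.
Qed.

Lemma form_cvg_indep u v u' v' x y x' y' :
  form_cvg t u x -> form_cvg t v y ->
  form_cvg t u' x' -> form_cvg t v' y' ->
  t (u n - u' n) (u n - u' n) @[n --> \oo] --> (0 : C^o) ->
  t (v n - v' n) (v n - v' n) @[n --> \oo] --> (0 : C^o) ->
  t (u n) (v n) - t (u' n) (v' n) @[n --> \oo] --> (0 : C^o).
Proof.
move=> ux vy ux' vy' uu vv; have [[Bu [Bu0 uB]] [Bv [Bv0 vB]]] :=
  (form_cvg_bounded ux', form_cvg_bounded vy).
case: ux vy ux' vy' => [Du _ _] [Dv _ _] [Du' _ _] [Dv' _ _].
apply: (@form_diff_cvg0 _ _ _ u v u' v' (Bu + Bv)) => //=.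
- by rewrite addr_gt0.
- by apply: filterS vB => n /le_trans; apply; rewrite lerDr ltW.
- by apply: filterS uB => n /le_trans; apply; rewrite lerDl ltW.
Qed.

Lemma form_cvg_lin a u v x y : form_cvg t u x -> form_cvg t v y ->
  form_cvg t (fun n => a *: u n + v n) (a *: x + y).
Proof.
move=> [Du ux u0] [Dv vy v0]; split=> [n||]; first exact: form_dom_lin.
  by apply: cvgD => //; exact: cvgZl_tmp.
(* Null family dominating the diagonal of the differences, by the bound for [t[x + y]] and [t[a x] =
   |a|^2 t[x]]. *)
have h : 2 * (a * a^* * t (u nm.1 - u nm.2) (u nm.1 - u nm.2)
    + t (v nm.1 - v nm.2) (v nm.1 - v nm.2)) @[nm --> (\oo, \oo)] --> (0 : C^o).
  apply: (eq_ccvg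
    (ccvgMl (c := 2) (ccvgD (ccvgMl (c := a * a^*) u0) v0))) => //.
  by rewrite mulr0 addr0 mulr0.
apply: (@cvg_dominated0 _ _ _ _ C^o _ _ _ h).
apply: nearW => -[n m] /=.
have -> : a *: u n + v n - (a *: u m + v m) = a *: (u n - u m) + (v n - v m).
  by rewrite scalerBr opprD addrACA.
have [Du1 Dv1] := (form_domB (Du n) (Du m), form_domB (Dv n) (Dv m)).
have Dau := form_domZ a Du1.
rewrite ger0_norm; last by apply: form_ge0 => //; exact: form_domD.
apply: le_trans (form_sum_le t_ge0 Dau Dv1) _.
by rewrite formZl // formZr // mulrA.
Qed.

End NonnegativeForms.

(** * Semibounded forms *)

Section Shift.
Variables (R : realType) (H : hilbertType R).
Local Notation C := R[i].
Implicit Types (t : sesqform H) (c : R) (x y : H) (u v : nat -> H).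

Lemma inner_antilinear (a : C) x y z :
  inner z (a *: x + y) = a^* * inner z x + inner z y.
Proof. exact: (linearPr inner z a x y). Qed.

Lemma setT_subspace : linear_subspace [set: H].
Proof. by []. Qed.

(** Viewing the inner product as a nonnegative form makes the preceding limit results yield its
    continuity. *)
Definition inner_form : sesqform H :=
  @Form R H setT (fun x y => inner x y) setT_subspace
    (fun a x y z _ _ _ => linearPl inner z a x y)
    (fun a x y z _ _ _ => inner_antilinear a x y z).

Lemma inner_form_ge0 : form_ge inner_form 0.
Proof. by move=> x _; rewrite mul0r /= -sqr_normE exprn_ge0. Qed.

Lemma cvg_pair_sub u x : u n @[n --> \oo] --> x ->
  u nm.1 - u nm.2 @[nm --> (\oo, \oo)] --> (0 : H).
Proof.
move=> ux; rewrite -(subrr x).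
by apply: cvgB; [exact: cvg_comp cvg_fst ux|exact: cvg_comp cvg_snd ux].
Qed.

Lemma inner_diag_cvg0 (T : Type) (F : set_system T) {FF : Filter F} f :
  f x @[x --> F] --> (0 : H) -> inner (f x) (f x) @[x --> F] --> (0 : C^o).
Proof.
by move=> /ccvg_sqr_norm0 h; apply: (eq_ccvg h) => // x; exact: sqr_normE.
Qed.

Lemma inner_form_cvg u x : u n @[n --> \oo] --> x -> form_cvg inner_form u x.
Proof.
by move=> ux; split=> //; apply: inner_diag_cvg0; exact: cvg_pair_sub ux.
Qed.

(** The sequences are compared with the constant ones at [x] and [y], for the inner product viewed
    as a form. *)
Lemma inner_cvg u v x y : u n @[n --> \oo] --> x -> v n @[n --> \oo] --> y ->
  inner (u n) (v n) @[n --> \oo] --> (inner x y : C^o).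
Proof.
move=> ux vy; apply: ccvg_sub0.
have cst z : form_cvg inner_form (fun=> z) z.
  by apply: inner_form_cvg; exact: cvg_cst.
apply: (@form_cvg_indep _ _ _ inner_form_ge0
    u v (fun=> x) (fun=> y) x y x y) => //;
  [exact: inner_form_cvg..| |]; apply: inner_diag_cvg0.
  by rewrite -(subrr x); apply: cvgB ux _; exact: cvg_cst.
by rewrite -(subrr y); apply: cvgB vy _; exact: cvg_cst.
Qed.

Lemma shift_linear t c (a : C) x y z :
  form_dom t x -> form_dom t y -> form_dom t z ->
  t (a *: x + y) z - c%:C%C * inner (a *: x + y) z =
  a * (t x z - c%:C%C * inner x z) + (t y z - c%:C%C * inner y z).
Proof. by move=> Dx Dy Dz; rewrite form_linear // linearPl /=; ring. Qed.

Lemma shift_antilinear t c (a : C) x y z :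
  form_dom t x -> form_dom t y -> form_dom t z ->
  t z (a *: x + y) - c%:C%C * inner z (a *: x + y) =
  a^* * (t z x - c%:C%C * inner z x) + (t z y - c%:C%C * inner z y).
Proof.
by move=> Dx Dy Dz; rewrite form_antilinear // inner_antilinear; ring.
Qed.

Definition shift_form t c : sesqform H :=
  Form (form_domP t) (@shift_linear t c) (@shift_antilinear t c).

Lemma shift_form_ge0 t c : form_ge t c <-> form_ge (shift_form t c) 0.
Proof.
split=> tc x Dx; have := tc x Dx; rewrite /= mul0r sqr_normE subr_ge0 //.
Qed.

(** The two diagonals differ by [c |f|^2], which vanishes in the limit. This is how results on
    nonnegative forms pass to semibounded ones. *)
Lemma shift_diag_cvg0 t c (T : Type) (F : set_system T) {FF : Filter F} f :
  f x @[x --> F] --> (0 : H) ->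
  t (f x) (f x) @[x --> F] --> (0 : C^o) <->
  shift_form t c (f x) (f x) @[x --> F] --> (0 : C^o).
Proof.
move=> /inner_diag_cvg0 i0.
have ci : c%:C%C * inner (f x) (f x) @[x --> F] --> (0 : C^o).
  by apply: (eq_ccvg (ccvgMl (c := c%:C%C) i0)) => //; rewrite mulr0.
split=> h.
  by apply: (eq_ccvg (ccvgB h ci)) => //; rewrite subr0.
apply: (eq_ccvg (ccvgD h ci)) => [x|]; last by rewrite addr0.
by rewrite /= subrK.
Qed.

Lemma shift_form_cvg t c u x : form_cvg t u x <-> form_cvg (shift_form t c) u x.
Proof.
by split=> -[Du ux u0]; split=> //;
  have /(shift_diag_cvg0 t c) h := cvg_pair_sub ux; apply/h.
Qed.

End Shift.

(** * Convergence for semibounded forms *)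

Section Semibounded.
Variables (R : realType) (H : hilbertType R).
Local Notation C := R[i].
Implicit Types (t s : sesqform H) (x y : H) (u v : nat -> H).

Lemma form_cvg_cst t x : form_dom t x -> form_cvg t (fun=> x) x.
Proof.
move=> Dx; split=> //; first exact: cvg_cst.
rewrite subrr form0l; last exact: form_dom0.
exact: (@cvg_cst C^o).
Qed.

Lemma semibounded_cvg_lin t a u v x y : semibounded t ->
  form_cvg t u x -> form_cvg t v y ->
  form_cvg t (fun n => a *: u n + v n) (a *: x + y).
Proof.
move=> [c /shift_form_ge0 tc] /(shift_form_cvg t c) ux /(shift_form_cvg t c) vy.
by apply/(shift_form_cvg t c); exact: form_cvg_lin.
Qed.

Lemma semibounded_cvg_sub t u v x y : semibounded t ->
  form_cvg t u x -> form_cvg t v y -> form_cvg t (fun n => u n - v n) (x - y).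
Proof.
move=> tsb ux vy; have := semibounded_cvg_lin (-1) tsb vy ux.
rewrite scaleN1r addrC; congr (form_cvg _ _ _).
by apply/funext => n; rewrite scaleN1r addrC.
Qed.

(** The sequences [u - u'] and [v - v'] are [t]-convergent to 0, so closability makes their
    diagonals vanish. The nonnegative case then applies to [t - c], and the inner product terms are
    added back. *)
Lemma closable_cvg_indep t u v u' v' x y : semibounded t -> form_closable t ->
  form_cvg t u x -> form_cvg t v y -> form_cvg t u' x -> form_cvg t v' y ->
  t (u n) (v n) - t (u' n) (v' n) @[n --> \oo] --> (0 : C^o).
Proof.
move=> tsb tcl ux vy ux' vy'; have [c /shift_form_ge0 tc] := tsb.
have diag w w' z : form_cvg t w z -> form_cvg t w' z ->
    shift_form t c (w n - w' n) (w n - w' n) @[n --> \oo] --> (0 : C^o).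
  move=> wz wz'; have := semibounded_cvg_sub tsb wz wz'; rewrite subrr => h.
  by case: (h) => _ w0 _; exact: (shift_diag_cvg0 t c w0).1 (tcl _ h).
have [uu vv] := (diag _ _ _ ux ux', diag _ _ _ vy vy').
have inn : inner (u n) (v n) - inner (u' n) (v' n) @[n --> \oo] --> (0 : C^o).
  case: ux vy ux' vy' => [_ ux _] [_ vy _] [_ ux' _] [_ vy' _].
  apply: (eq_ccvg (ccvgB (inner_cvg ux vy) (inner_cvg ux' vy'))) => //.
  by rewrite subrr.
have shift w z : form_cvg t w z -> form_cvg (shift_form t c) w z.
  by move/(shift_form_cvg t c).
have h := form_cvg_indep tc (shift _ _ ux) (shift _ _ vy)
  (shift _ _ ux') (shift _ _ vy') uu vv.
apply: (eq_ccvg (ccvgD h (ccvgMl (c := c%:C%C) inn))) => [n|].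
  by rewrite /=; ring.
by rewrite mulr0 addr0.
Qed.

Lemma semibounded_cvg t u v x y : semibounded t ->
  form_cvg t u x -> form_cvg t v y ->
  exists l : C^o, t (u n) (v n) @[n --> \oo] --> l.
Proof.
move=> [c /shift_form_ge0 tc] ux vy.
have [sux svy] :=
  ((shift_form_cvg t c u x).1 ux, (shift_form_cvg t c v y).1 vy).
have [l ul] := form_cvg_cauchy tc sux svy.
case: ux vy => [_ ux _] [_ vy _].
exists (l + c%:C%C * inner x y).
apply: (eq_ccvg (ccvgD ul (ccvgMl (c := c%:C%C) (inner_cvg ux vy)))) => // n.
by rewrite /= subrK.
Qed.

(** This is closedness at the limit point 0. *)
Lemma closed_closable s : form_closed s -> form_closable s.
Proof.
move=> scl u /scl[_ h]; apply: (eq_ccvg h) => // n.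
by rewrite subr0.
Qed.

End Semibounded.

(** * The closure of a form *)

Section Closure.
Variables (R : realType) (H : hilbertType R) (t : sesqform H).
Hypotheses (t_sb : semibounded t) (t_closable : form_closable t).
Local Notation C := R[i].
Implicit Types (x y z : H) (u v : nat -> H).

Definition closure_dom : set H := [set x | exists u, form_cvg t u x].

(** A chosen [t]-approximating sequence; outside [closure_dom] the choice falls back on the zero
    sequence. *)
Definition approx_seq x : nat -> H := xget (fun=> 0) [set u | form_cvg t u x].

Definition closure_val x y : C :=
  lim (t (approx_seq x n) (approx_seq y n) @[n --> \oo] : set_system C^o).

Lemma approx_seqP x : closure_dom x -> form_cvg t (approx_seq x) x.
Proof. by move=> h; have := xgetPex (fun=> 0) h. Qed.

(** Along the chosen sequences the limit exists by the Cauchy property; closability transfers it to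
    any other approximating sequences. *)
Lemma closure_val_cvg u v x y : form_cvg t u x -> form_cvg t v y ->
  t (u n) (v n) @[n --> \oo] --> (closure_val x y : C^o).
Proof.
move=> ux vy.
have ax : form_cvg t (approx_seq x) x by apply: approx_seqP; exists u.
have ay : form_cvg t (approx_seq y) y by apply: approx_seqP; exists v.
have [l tl] := semibounded_cvg t_sb ax ay.
have -> : closure_val x y = l.
  by apply: (@cvg_lim C^o); [exact: norm_hausdorff|exact: tl].
have d := closable_cvg_indep t_sb t_closable ux vy ax ay.
by apply: (eq_ccvg (ccvgD d tl)) => [n|]; [rewrite subrK|rewrite add0r].
Qed.

Lemma closure_domP : linear_subspace closure_dom.
Proof.
split; first by exists (fun=> 0); apply: form_cvg_cst; exact: form_dom0.
move=> a x y [u ux] [v vy]; exists (fun n => a *: u n + v n).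
exact: semibounded_cvg_lin.
Qed.

Lemma closure_linear a x y z :
  closure_dom x -> closure_dom y -> closure_dom z ->
  closure_val (a *: x + y) z = a * closure_val x z + closure_val y z.
Proof.
move=> [u ux] [v vy] [w wz].
have uvxy := semibounded_cvg_lin a t_sb ux vy.
apply: (ccvg_unique (closure_val_cvg uvxy wz)).
apply: (eq_ccvg (ccvgD (ccvgMl (c := a) (closure_val_cvg ux wz))
  (closure_val_cvg vy wz))) => // n.
by case: ux vy wz => [Du _ _] [Dv _ _] [Dw _ _]; rewrite form_linear.
Qed.

Lemma closure_antilinear a x y z :
  closure_dom x -> closure_dom y -> closure_dom z ->
  closure_val z (a *: x + y) = a^* * closure_val z x + closure_val z y.
Proof.
move=> [u ux] [v vy] [w wz].
have uvxy := semibounded_cvg_lin a t_sb ux vy.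
apply: (ccvg_unique (closure_val_cvg wz uvxy)).
apply: (eq_ccvg (ccvgD (ccvgMl (c := a^*) (closure_val_cvg wz ux))
  (closure_val_cvg wz vy))) => // n.
by case: ux vy wz => [Du _ _] [Dv _ _] [Dw _ _]; rewrite form_antilinear.
Qed.

Definition closure_form : sesqform H :=
  Form closure_domP closure_linear closure_antilinear.
Local Notation tb := closure_form.

Lemma closure_extends : form_extension t tb.
Proof.
split=> [x Dx|x y Dx Dy]; first by exists (fun=> x); exact: form_cvg_cst.
have h := closure_val_cvg (form_cvg_cst Dx) (form_cvg_cst Dy).
by apply: (ccvg_unique h); exact: (@cvg_cst C^o).
Qed.

Lemma closure_form_ge c : form_ge t c -> form_ge tb c.
Proof.
move=> tc x [u ux]; have [Du uxH _] := ux.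
rewrite sqr_normE -subr_ge0.
have ge0 : \forall n \near \oo,
    0 <= t (u n) (u n) - c%:C%C * inner (u n) (u n).
  by apply: nearW => n; rewrite subr_ge0 -sqr_normE; exact: tc.
exact: (cvg_ge0 ge0
  (ccvgB (closure_val_cvg ux ux) (ccvgMl (c := c%:C%C) (inner_cvg uxH uxH)))).
Qed.

Lemma closure_semibounded : semibounded tb.
Proof. by have [c tc] := t_sb; exists c; exact: closure_form_ge. Qed.

Lemma closure_form_geE c : form_ge tb c <-> form_ge t c.
Proof.
split; last exact: closure_form_ge.
move=> tbc x Dx; have [sub ext] := closure_extends.
by rewrite -ext //; apply: tbc; exact: sub.
Qed.

(** For fixed [n] the sequence [v_n - v_m] in [m] is [t]-convergent to [v_n - y], so [tb[v_n - y]]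
    is the limit over [m] of [t[v_n - v_m]], which is small for large [n]. *)
Lemma closure_approx v y : form_cvg t v y ->
  tb (v n - y) (v n - y) @[n --> \oo] --> (0 : C^o).
Proof.
move=> vy; have [Dv _ /(pair_cvg0P (V := C^o)) v0] := vy.
apply/(@cvgr0Pnorm_le _ C^o) => e /v0[N NP]; exists N => // n /= nN.
have h : form_cvg t (fun m => v n - v m) (v n - y).
  by apply: semibounded_cvg_sub vy => //; exact: form_cvg_cst.
apply: (ccvg_norm_le _ (closure_val_cvg h h)).
by exists N => // m /= mN; exact/ltW/(NP n m).
Qed.

(** Diagonal argument: each [u_n] is replaced by some [v_n] in [form_dom t], close to it both in
    norm and in [q = tb - c]. Then [v] is [t]-convergent to [x], which puts [x] in the domain, and
    [u_n - x] is controlled through [v_n]. *)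
Lemma closure_closed : form_closed tb.
Proof.
move=> u x ux; have [Du uxH _] := ux.
have [c tbc] := closure_semibounded; have q_ge0 := (shift_form_ge0 tb c).1 tbc.
pose q := shift_form tb c; have [sub ext] := closure_extends.
have Dq y z : form_dom tb y -> form_dom tb z -> form_dom q (y - z).
  exact: (@form_domB _ _ tb).
have /choice[v vP] n : exists z, [/\ form_dom t z,
    `|z - u n| <= (n.+1%:R^-1)%:C%C &
    q (z - u n) (z - u n) <= (n.+1%:R^-1)%:C%C].
  (* A late enough term of a sequence approximating [u n] meets both bounds at once. *)
  have [w wu] := Du n; have [Dw wuH _] := wu.
  have wu0 : w m - u n @[m --> \oo] --> (0 : H) by exact/subr_cvg0.
  have qw0 : q (w m - u n) (w m - u n) @[m --> \oo] --> (0 : C^o).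
    exact: (shift_diag_cvg0 tb c wu0).1 (closure_approx wu).
  have e0 : 0 < (n.+1%:R^-1)%:C%C :> C by rewrite ltcR invr_gt0.
  have H1 : \forall m \near \oo, `|w m - u n| <= (n.+1%:R^-1)%:C%C.
    exact: (@cvgr0_norm_le _ _ _ _ _ _ wu0 _ e0).
  have H2 : \forall m \near \oo,
      `|q (w m - u n) (w m - u n)| <= (n.+1%:R^-1)%:C%C.
    exact: (@cvgr0_norm_le _ C^o _ _ _ _ qw0 _ e0).
  have [m [h1 h2]] := @filter_ex _ \oo _ _ (filterI H1 H2).
  exists (w m); split=> //; move: h2; rewrite ger0_norm //.
  by apply: (form_ge0 q_ge0); apply: Dq => //; exact: sub.
have Dv n : form_dom t (v n) by case: (vP n).
have Dvb n : form_dom tb (v n) by exact: sub.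
have Dvu n : form_dom q (v n - u n) by exact: Dq.
have vu0 : v n - u n @[n --> \oo] --> (0 : H).
  apply: (cvg_dominated0 _ (@ccvg_harmonic R)).
  by apply: nearW => n; case: (vP n).
have qvu0 : q (v n - u n) (v n - u n) @[n --> \oo] --> (0 : C^o).
  apply: (@cvg_dominated0 _ _ _ _ C^o _ _ _ (@ccvg_harmonic R)).
  apply: nearW => n; case: (vP n) => _ _; rewrite ger0_norm //.
  exact: (form_ge0 q_ge0).
have vx : v n @[n --> \oo] --> x.
  have h : v n - u n + u n @[n --> \oo] --> 0 + x by exact: cvgD vu0 uxH.
  have e : (fun n => v n - u n + u n) = v by apply/funext => n; rewrite subrK.
  by move: h; rewrite e add0r.
have tvx : form_cvg t v x.
  split=> //.
  suff qv0 : q (v nm.1 - v nm.2) (v nm.1 - v nm.2)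
      @[nm --> (\oo, \oo)] --> (0 : C^o).
    apply: (eq_ccvg ((shift_diag_cvg0 tb c (cvg_pair_sub vx)).2 qv0)) => // nm.
    by apply: ext; exact: form_domB.
  have [_ _ qu0] := (shift_form_cvg tb c u x).1 ux.
  have q1 : q (v nm.1 - u nm.1) (v nm.1 - u nm.1)
      @[nm --> (\oo, \oo)] --> (0 : C^o).
    exact: cvg_comp cvg_fst qvu0.
  have q2 : q (v nm.2 - u nm.2) (v nm.2 - u nm.2)
      @[nm --> (\oo, \oo)] --> (0 : C^o).
    exact: cvg_comp cvg_snd qvu0.
  (* The nested factors 2 come from splitting [v_n - v_m] into [v_n - u_n] and
     [(u_n - u_m) - (v_m - u_m)], then splitting the latter again. *)
  have qq : 2 * (q (v nm.1 - u nm.1) (v nm.1 - u nm.1) +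
      2 * (q (u nm.1 - u nm.2) (u nm.1 - u nm.2) +
      q (v nm.2 - u nm.2) (v nm.2 - u nm.2)))
      @[nm --> (\oo, \oo)] --> (0 : C^o).
    apply: (eq_ccvg (ccvgMl (c := 2)
      (ccvgD q1 (ccvgMl (c := 2) (ccvgD qu0 q2))))) => //.
    by rewrite !(addr0, mulr0).
  apply: (@cvg_dominated0 _ _ _ _ C^o _ _ _ qq).
  apply: nearW => -[n m] /=.
  have Du1 : form_dom q (u n - u m) by exact: Dq.
  rewrite ger0_norm; last by apply: (form_ge0 q_ge0); exact: Dq.
  have -> : v n - v m = (v n - u n) + ((u n - u m) - (v m - u m)).
    by rewrite opprB !subrKA.
  apply: le_trans (form_sum_le q_ge0 _ _) _ => //.
    exact: form_domB Du1 (Dvu m).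
  by rewrite ler_pM2l // lerD2l; exact: form_sub_le.
have Dx : form_dom tb x by exists v.
split=> //.
have uxs : u n - x @[n --> \oo] --> (0 : H) by exact/subr_cvg0.
have vxs : v n - x @[n --> \oo] --> (0 : H) by exact/subr_cvg0.
apply: (shift_diag_cvg0 tb c uxs).2.
have q1 : q (v n - x) (v n - x) @[n --> \oo] --> (0 : C^o).
  exact: (shift_diag_cvg0 tb c vxs).1 (closure_approx tvx).
have qq : 2 * (q (v n - x) (v n - x) + q (v n - u n) (v n - u n))
    @[n --> \oo] --> (0 : C^o).
  apply: (eq_ccvg (ccvgMl (c := 2) (ccvgD q1 qvu0))) => //.
  by rewrite !(addr0, mulr0).
apply: (@cvg_dominated0 _ _ _ _ C^o _ _ _ qq); apply: nearW => n.
have Dvx : form_dom q (v n - x) by exact: Dq.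
rewrite ger0_norm; last by apply: (form_ge0 q_ge0); exact: Dq.
have -> : u n - x = (v n - x) - (v n - u n) by rewrite opprB [RHS]addrC subrKA.
exact: form_sub_le.
Qed.

(** A [t]-convergent sequence is [s]-convergent, so closedness of [s] puts its limit in
    [form_dom s]. As [s] is itself closable, comparison with constant sequences shows that [s x y]
    is the same limit of [t (u n) (v n)]. *)
Lemma closure_smallest s : semibounded s -> form_closed s ->
  form_extension t s -> form_extension tb s.
Proof.
move=> ssb scl [sub ext].
have scvg u x : form_cvg t u x -> form_cvg s u x.
  move=> [Du ux u0]; split=> // [n|]; first exact: sub.
  by apply: (eq_ccvg u0) => // nm; rewrite ext //; exact: form_domB.
split=> [x [u /scvg/scl[]] //|x y [u ux] [v vy]].
have [[sux svy] [[Dx _] [Dy _]]] :=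
  ((scvg _ _ ux, scvg _ _ vy), (scl _ _ (scvg _ _ ux), scl _ _ (scvg _ _ vy))).
have d := closable_cvg_indep ssb (closed_closable scl) sux svy
  (form_cvg_cst Dx) (form_cvg_cst Dy).
apply: (ccvg_unique (ccvg_sub0 d)).
apply: (eq_ccvg (closure_val_cvg ux vy)) => // n.
by case: ux vy => [Du _ _] [Dv _ _]; rewrite ext.
Qed.

Lemma closure_formP : form_closure t tb.
Proof.
split; [exact: closure_semibounded|exact: closure_closed
  |exact: closure_extends|exact: closure_smallest].
Qed.

Lemma lower_bound_closure : lower_bound tb = lower_bound t.
Proof.
by congr sup; apply/seteqP; split=> c /closure_form_geE.
Qed.

End Closure.

(** * Representing maps *)

Section Operators.
Variables (R : realType) (H K : hilbertType R).
Local Notation C := R[i].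
Implicit Types (Q : operator H K) (x y : H) (z w : K) (u v : nat -> H).

Lemma pair_cauchy_cvg (f : nat -> K) :
  f nm.1 - f nm.2 @[nm --> (\oo, \oo)] --> (0 : K) ->
  exists z, f n @[n --> \oo] --> z.
Proof.
move=> /pair_cvg0P f0; apply/cvg_ex/cauchy_cvgP; apply: cauchy_exP.
move=> e /f0[N NP]; exists (f N); exists N => // n /= nN.
rewrite -ball_normE /=.
exact: NP N n (leqnn N) nN.
Qed.

Lemma op_sub Q x y : op_dom Q x -> op_dom Q y -> Q (x - y) = Q x - Q y.
Proof.
by move=> Dx Dy; rewrite addrC -scaleN1r op_linear // scaleN1r addrC.
Qed.

(** The product of metric topologies is sequential: points of the graph are chosen in the products
    of balls of radius [1/(n+1)]. *)
Lemma closure_graphP Q x z : closure (op_graph Q) (x, z) <->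
  exists u, [/\ forall n, op_dom Q (u n), u n @[n --> \oo] --> x &
    Q (u n) @[n --> \oo] --> z].
Proof.
split=> [clz|[u [Du ux Qz]] B Bxz]; last first.
  have uQ : (u n, Q (u n)) @[n --> \oo] --> (x, z) by exact: cvg_pair.
  have [n Bn] := @filter_ex _ \oo _ _ (uQ _ Bxz).
  by exists (u n, Q (u n)); split; [split; [exact: Du|]|exact: Bn].
have /choice[u uP] n : exists y, [/\ op_dom Q y,
    `|y - x| <= (n.+1%:R^-1)%:C%C & `|Q y - z| <= (n.+1%:R^-1)%:C%C].
  have e0 : 0 < (n.+1%:R^-1)%:C%C :> C by rewrite ltcR invr_gt0.
  pose B := ball x (n.+1%:R^-1)%:C%C `*` ball z (n.+1%:R^-1)%:C%C.
  have /clz[[y w] [/= [/= Dy wQ] [/= xy zw]]] : nbhs (x, z) B.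
    exists (ball x (n.+1%:R^-1)%:C%C, ball z (n.+1%:R^-1)%:C%C) => //.
    by split; exact: nbhsx_ballx.
  exists y; move: xy zw; rewrite -!ball_normE wQ /= => /ltW xy /ltW zw.
  by split; rewrite // distrC.
exists u; split=> [n||]; first by case: (uP n).
  apply/subr_cvg0; apply: (cvg_dominated0 _ (@ccvg_harmonic R)).
  by apply: nearW => n; case: (uP n).
apply/subr_cvg0; apply: (cvg_dominated0 _ (@ccvg_harmonic R)).
by apply: nearW => n; case: (uP n).
Qed.

(** * The closure of a representing map *)

Section Representing.
Variables (t : sesqform H) (c : R) (Q : operator H K).
Hypotheses (t_sb : semibounded t) (t_closable : form_closable t).
Hypotheses (Q_rep : representing_map t c Q) (Q_closable : op_closable Q).

Lemma representing_map_dom : op_dom Q = form_dom t.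
Proof. by case: Q_rep. Qed.

Lemma representing_map_sqr_norm x y : form_dom t x -> form_dom t y ->
  `|Q x - Q y| ^+ 2 = shift_form t c (x - y) (x - y).
Proof.
case: (Q_rep) => DQ QE Dx Dy; rewrite -op_sub ?DQ // sqr_normE /=.
by rewrite QE //; exact: form_domB.
Qed.

(** Since [|Q u_n - Q u_m|^2 = (t - c)[u_n - u_m]], the Cauchy condition on [t] is that of [Q u_n],
    and [K] is complete. *)
Lemma form_cvg_representing u x : form_cvg t u x <->
  [/\ forall n, form_dom t (u n), u n @[n --> \oo] --> x &
    exists z, Q (u n) @[n --> \oo] --> z].
Proof.
split=> [ux|[Du ux [z Qz]]].
  have [_ _ su0] := (shift_form_cvg t c u x).1 ux.
  case: ux => Du ux _; split=> //; apply: pair_cauchy_cvg.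
  apply/ccvg_sqr_norm0; apply: (eq_ccvg su0) => // nm.
  by rewrite representing_map_sqr_norm.
split=> //; apply: (shift_diag_cvg0 t c (cvg_pair_sub ux)).2.
have /ccvg_sqr_norm0 h := cvg_pair_sub Qz.
by apply: (eq_ccvg h) => // nm; rewrite representing_map_sqr_norm.
Qed.

(** The second coordinate over [x] in the closed graph, single-valued by closability of [Q]; the
    default is 0 where there is none. *)
Definition op_closure_val x : K :=
  xget 0 [set z | closure (op_graph Q) (x, z)].

Lemma op_closure_val_unique x z :
  closure (op_graph Q) (x, z) -> op_closure_val x = z.
Proof.
move=> xz; apply: (@Q_closable x) => //.
by have := xgetPex 0 (ex_intro (fun z => closure (op_graph Q) (x, z)) z xz).
Qed.

Lemma closure_graph_dom x :
  (exists z, closure (op_graph Q) (x, z)) <-> closure_dom t x.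
Proof.
split=> [[z /closure_graphP[u [Du ux Qz]]]|
         [u /form_cvg_representing[Du ux [z Qz]]]].
  exists u; apply/form_cvg_representing; split=> //; last by exists z.
  by rewrite -representing_map_dom.
exists z; apply/closure_graphP; exists u; split=> //.
by rewrite representing_map_dom.
Qed.

Lemma closure_graph_lin (a : C) x y z w :
  closure (op_graph Q) (x, z) -> closure (op_graph Q) (y, w) ->
  closure (op_graph Q) (a *: x + y, a *: z + w).
Proof.
move=> /closure_graphP[u [Du ux Qu]] /closure_graphP[v [Dv vy Qv]].
apply/closure_graphP; exists (fun n => a *: u n + v n); split=> [n||].
- by case: (op_domP Q) => _; exact.
- by apply: cvgD vy; exact: cvgZl_tmp.
have -> : (fun n => Q (a *: u n + v n)) = (fun n => a *: Q (u n) + Q (v n)).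
  by apply/funext => n; rewrite op_linear.
by apply: cvgD Qv; exact: cvgZl_tmp.
Qed.

Lemma op_closure_val_linear a x y : closure_dom t x -> closure_dom t y ->
  op_closure_val (a *: x + y) = a *: op_closure_val x + op_closure_val y.
Proof.
move=> /closure_graph_dom[z xz] /closure_graph_dom[w yw].
rewrite (op_closure_val_unique xz) (op_closure_val_unique yw).
exact/op_closure_val_unique/closure_graph_lin.
Qed.

(** Taking [closure_dom t] as the domain makes it agree with that of [closure_form] by
    definition. *)
Definition closure_op : operator H K :=
  Operator (closure_domP t_sb) op_closure_val_linear.

Lemma closure_opP : op_closure Q closure_op.
Proof.
apply/seteqP; split=> -[x z] /=; rewrite /op_graph /=.
  by move=> [/closure_graph_dom[w xw] ->]; rewrite (op_closure_val_unique xw).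
move=> xz; split; last by rewrite (op_closure_val_unique xz).
by apply/closure_graph_dom; exists z.
Qed.

(** The representing identity at [u_n], [v_n] passes to the limit, both sides being continuous along
    these sequences. *)
Lemma closure_op_representing x y : closure_dom t x -> closure_dom t y ->
  closure_val t x y - c%:C%C * inner x y = inner (closure_op x) (closure_op y).
Proof.
move=> [u ux] [v vy]; have tuv := closure_val_cvg t_sb t_closable ux vy.
have [[Du uxH [z Qu]] [Dv vyH [w Qv]]] :=
  ((form_cvg_representing u x).1 ux, (form_cvg_representing v y).1 vy).
have xz : closure (op_graph Q) (x, z).
  by apply/closure_graphP; exists u; rewrite representing_map_dom.
have yw : closure (op_graph Q) (y, w).
  by apply/closure_graphP; exists v; rewrite representing_map_dom.
rewrite /= (op_closure_val_unique xz) (op_closure_val_unique yw).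
apply: (ccvg_unique (ccvgB tuv (ccvgMl (c := c%:C%C) (inner_cvg uxH vyH)))).
apply: (eq_ccvg (inner_cvg Qu Qv)) => // n.
by case: Q_rep => _ QE; rewrite QE.
Qed.

End Representing.
End Operators.

Theorem lemma2p6 (R : realType) (H : hilbertType R) (t : sesqform H)
    (t_nontrivial : exists2 x : H, form_dom t x & x != 0)
    (t_semibounded : semibounded t) (t_closable : form_closable t) :
  exists tb : sesqform H,
    [/\ form_closure t tb,
        forall x : H, form_dom tb x <-> exists u : nat -> H, form_cvg t u x,
        forall (x y : H) (u v : nat -> H), form_cvg t u x -> form_cvg t v y ->
          t (u n) (v n) @[n --> \oo] --> (tb x y : R[i]^o),
        lower_bound tb = lower_bound t &
        forall (c : R) (K : hilbertType R) (Q : operator H K),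
          c <= lower_bound t -> representing_map t c Q -> op_closable Q ->
          exists Qb : operator H K,
            [/\ op_closure Q Qb,
                form_dom tb = op_dom Qb &
                forall x y : H, form_dom tb x -> form_dom tb y ->
                  tb x y - c%:C%C * inner x y = inner (Qb x) (Qb y)]].
Proof.
exists (closure_form t_semibounded t_closable); split.
- exact: closure_formP.
- by [].
- by move=> x y u v; exact: closure_val_cvg.
- exact: lower_bound_closure.
move=> c K Q _ Q_rep Q_closable.
exists (closure_op t_semibounded Q_rep Q_closable); split=> //.
  exact: closure_opP.
exact: closure_op_representing.
Qed.
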